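(* Let $\Delta \ge 1$ be an integer and let $n_\Delta = 2^\Delta - 1$. Let $D_{n_\Delta}$ be the dihedral group of order $2n_\Delta$, presented as $D_{n_\Delta} = \langle w, x \mid w^2 = e,\ wxw^{-1} = x^{-1},\ x^{n_\Delta} = e\rangle$. Let $S = \{w x^{2^{k-1}-1} : k = 1, 2, \dots, \Delta\} = \{w, wx^1, wx^3, \dots, wx^{2^{\Delta-1}-1}\}$. Then the Cayley graph $(D_{n_\Delta}, S)$ is an optimal $(\Delta, \Delta+1)$-broadcast network. That is, it has maximum degree $\Delta$, broadcast time at most $\Delta+1$, and order $2^{\Delta+1}-2 = B(\Delta, \Delta+1)$.
   Context: Graphs are simple, undirected and connected. For a group $A$ and a generating set $S \subseteq A$ closed under inverses, the Cayley graph $(A,S)$ has vertex set $A$, and $a,b$ are adjacent iff $as = b$ for some $s \in S$. (Every element of $S$ above is an involution, so $S$ is closed under inverses.) Broadcasting: a message originates at a vertex $u$. In each unit time step, every vertex that already knows the message may call at most one neighbor, and a called neighbor then knows the message. Each call involves exactly two vertices, and each vertex participates in at most one call per time step. The broadcast time $b(u)$ is the minimum number of time steps after which all vertices know the message. The broadcast time of $G$ is $b(G) = \max_{u} b(u)$. $B(\Delta,t)$ denotes the maximum possible order of a graph of maximum degree $\Delta$ and broadcast time at most $t$. A graph of maximum degree $\Delta$ and broadcast time at most $t$ is an optimal $(\Delta,t)$-broadcast network if its order equals $B(\Delta,t)$. *)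

(* Defs.v *)
From HB Require Import structures.
From mathcomp Require Import all_boot all_fingroup all_algebra.

Set Implicit Arguments.
Unset Strict Implicit.
Unset Printing Implicit Defensive.

Local Open Scope group_scope.

Record graph := Graph {
  vertex :> finType;
  adj : rel vertex;
  adj_sym : symmetric adj;
  adj_irr : irreflexive adj;
  adj_connected : forall u v : vertex, connect adj u v
}.

Definition order_of (G : graph) : nat := #|G|.

Definition max_degree (G : graph) : nat :=
  \max_(u : G) #|[set v | adj u v]|.

(* The calls placed in one time step form a set C of pairs (caller, callee);
   I is the set of vertices knowing the message when the step starts. *)
Definition valid_round (G : graph) (I : {set G}) (C : {set G * G}) : bool :=
  [forall c in C, (c.1 \in I) && adj c.1 c.2] &&
  [forall c in C, forall d in C,
     (c != d) ==> [disjoint [set c.1; c.2] & [set d.1; d.2]]].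

Definition after_round (G : graph) (I : {set G}) (C : {set G * G}) : {set G} :=
  I :|: [set c.2 | c in C].

Fixpoint valid_scheme (G : graph) (I : {set G}) (s : seq {set G * G}) : bool :=
  if s is C :: s' then valid_round I C && valid_scheme (after_round I C) s'
  else true.

Definition informed (G : graph) (I : {set G}) (s : seq {set G * G}) : {set G} :=
  foldl (@after_round G) I s.

Definition can_broadcast (G : graph) (u : G) (t : nat) : bool :=
  [exists s : t.-tuple {set G * G},
     valid_scheme [set u] s && (informed [set u] s == [set: G])].

Lemma connected_boundary (G : graph) (I : {set G}) (a b : G) :
  a \in I -> b \notin I ->
  exists c : G * G, [/\ c.1 \in I, c.2 \notin I & adj c.1 c.2].
Proof.
move=> aI; case/connectP: (adj_connected a b) => p; elim: p a aI => [|d p IHp] a aI /=.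
  by move=> _ ->; rewrite aI.
case/andP=> ead pth lst bI; have [dI|dI] := boolP (d \in I).
  exact: IHp dI pth lst bI.
by exists (a, d).
Qed.

Lemma can_broadcast_exists (G : graph) (u : G) : exists t, can_broadcast u t.
Proof.
suff [s sV sI] : exists2 s : seq {set G * G},
    valid_scheme [set u] s & informed [set u] s = [set: G].
  exists (size s); apply/existsP; exists (in_tuple s).
  by rewrite /= sV sI eqxx.
have: u \in [set u] by rewrite inE.
move: [set u] => I; have [n] := ubnP #|~: I|.
elim: n I => // n IHn I; rewrite ltnS => leIn uI.
have [/eqP IT | InT] := boolP (I == [set: G]); first by exists [::].
have [b bI] : exists b, b \notin I.
  apply/existsP; rewrite -negb_forall; apply: contra InT => /forallP IT.
  by apply/eqP/setP=> v; rewrite inE IT.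
have [[a d] /= [aI dI ead]] := connected_boundary uI bI.
pose C : {set G * G} := [set (a, d)].
have CE : after_round I C = d |: I.
  by rewrite /after_round imset_set1 /= setUC.
have [||s sV sI] := IHn (after_round I C).
- rewrite CE; apply: leq_trans leIn; apply: proper_card.
  rewrite properC properE subsetUr /=.
  by apply/subsetPn; exists d; rewrite // !inE eqxx.
- by rewrite CE !inE uI orbT.
exists (C :: s) => //=; rewrite sV andbT; apply/andP; split.
  by apply/forallP=> c; apply/implyP; rewrite inE => /eqP->; rewrite aI.
apply/forallP=> c; apply/implyP; rewrite inE => /eqP->.
by apply/forallP=> c'; apply/implyP; rewrite inE => /eqP->; rewrite eqxx.
Qed.

Definition broadcast_time_from (G : graph) (u : G) : nat :=
  ex_minn (can_broadcast_exists u).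

Definition broadcast_time (G : graph) : nat :=
  \max_(u : G) broadcast_time_from u.

(* is_max_order Delta t N states that N = B(Delta, t), the largest order of a
   graph of maximum degree exactly Delta and broadcast time at most t. *)
Definition is_max_order (Delta t N : nat) : Prop :=
  (exists G : graph,
     [/\ max_degree G = Delta, (broadcast_time G <= t)%N & order_of G = N]) /\
  (forall G : graph,
     max_degree G = Delta -> (broadcast_time G <= t)%N -> (order_of G <= N)%N).

Definition optimal_broadcast_network (Delta t : nat) (G : graph) : Prop :=
  [/\ max_degree G = Delta, (broadcast_time G <= t)%N &
      is_max_order Delta t (order_of G)].

(* 1 \notin S is what makes the Cayley graph loopless. *)
Definition connection_set (gT : finGroupType) (S : {set gT}) : Prop :=
  [/\ <<S>> = [set: gT], (forall s, s \in S -> s^-1 \in S) & 1 \notin S].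

Definition cayley_adj (gT : finGroupType) (S : {set gT}) : rel gT :=
  fun a b => [exists s in S, a * s == b].

Section CayleyGraph.
Variables (gT : finGroupType) (S : {set gT}).
Hypothesis hS : connection_set S.

Lemma cayley_sym : symmetric (cayley_adj S).
Proof.
have sub a b : cayley_adj S a b -> cayley_adj S b a.
  case/existsP=> s /andP[sS /eqP <-]; apply/existsP; exists s^-1.
  by case: hS => _ -> //; rewrite mulgK eqxx.
by move=> a b; apply/idP/idP; apply: sub.
Qed.

Lemma cayley_irr : irreflexive (cayley_adj S).
Proof.
move=> a; apply/existsP=> -[s /andP[sS /eqP as_a]].
case: hS => _ _ /negP[]; suff <- : s = 1 by [].
by apply: (mulgI a); rewrite as_a mulg1.
Qed.

Lemma cayley_connected (a b : gT) : connect (cayley_adj S) a b.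
Proof.
have: a^-1 * b \in <<S>> by case: hS => -> *; rewrite inE.
case/gen_prodgP=> n [c cS ab]; have {ab}-> : b = a * \prod_(i < n) c i.
  by rewrite -ab mulKVg.
elim: n c cS => [|n IHn] c cS; first by rewrite big_ord0 mulg1 connect0.
rewrite big_ord_recr /= mulgA.
apply: connect_trans (IHn (fun i => c (widen_ord (leqnSn n) i)) _) _ => //.
by apply: connect1; apply/existsP; exists (c ord_max); rewrite cS /=.
Qed.

Definition cayley_graph : graph :=
  Graph cayley_sym cayley_irr cayley_connected.

End CayleyGraph.

Definition dihedral_relations (n : nat) (gT : groupType) (w x : gT) : Prop :=
  [/\ w ^+ 2 = 1, w * x * w^-1 = x^-1 & x ^+ n = 1].

(* gT = < w, x | w^2, w x w^-1 = x^-1, x^n >: w and x generate gT, satisfy the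
   relations, and any pair satisfying them in any group is the image of (w, x)
   under a homomorphism. *)
Definition dihedral_presentation (n : nat) (gT : finGroupType) (w x : gT)
    : Prop :=
  [/\ <<[set w; x]>> = [set: gT],
      dihedral_relations n w x &
      forall (hT : groupType) (w' x' : hT), dihedral_relations n w' x' ->
        exists f : gT -> hT,
          [/\ {morph f : a b / a * b}, f w = w' & f x = x']].

Definition dihedral_generators (Delta : nat) (gT : finGroupType) (w x : gT) : {set gT} :=
  [set w * x ^+ (2 ^ (k - 1) - 1) | k : 'I_Delta.+1 & (1 <= k)%N].

(* A model of the dihedral group of order 2n.+2: the pair (b, i) stands for
   w ^+ b * x ^+ i. *)
Definition dihedral (n : nat) : Type := (bool * 'I_n.+1)%type.

Section DihedralModel.
Variable n : nat.
Implicit Types a b c : dihedral n.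

HB.instance Definition _ := Finite.on (dihedral n).

Definition flip (b : bool) (i : 'I_n.+1) : 'I_n.+1 := if b then (- i)%R else i.

Definition dih_mul a b : dihedral n :=
  (a.1 (+) b.1, (flip b.1 a.2 + b.2)%R).
Definition dih_one : dihedral n := (false, 0%R).
Definition dih_inv a : dihedral n := (a.1, (- flip a.1 a.2)%R).

Lemma dih_mulA : associative dih_mul.
Proof.
move=> [a i] [b j] [c k]; rewrite /dih_mul /= addbA; congr pair.
by case: b; case: c; rewrite /= ?GRing.opprD ?GRing.opprK GRing.addrA.
Qed.

Lemma dih_mul1g : left_id dih_one dih_mul.
Proof. by case=> [[] i]; rewrite /dih_mul /= ?GRing.oppr0 GRing.add0r. Qed.

Lemma dih_mulVg : left_inverse dih_one dih_inv dih_mul.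
Proof.
by case=> [[] i]; rewrite /dih_mul /dih_inv /= ?GRing.opprK GRing.addNr.
Qed.

HB.instance Definition _ :=
  Finite_isGroup.Build (dihedral n) dih_mulA dih_mul1g dih_mulVg.

Definition dih_w : dihedral n := (true, 0%R).
Definition dih_x : dihedral n := (false, inZp 1).

Lemma dih_xX m : dih_x ^+ m = (false, inZp m) :> dihedral n.
Proof.
elim: m => [|m IHm]; first by congr pair; apply: val_inj; rewrite /= mod0n.
rewrite expgSr IHm; congr pair; apply: val_inj => /=.
by rewrite modnDm addn1.
Qed.

Lemma dih_val a : a = dih_w ^+ a.1 * dih_x ^+ a.2 :> dihedral n.
Proof.
by case: a => [[] i]; rewrite dih_xX valZpK; congr pair;
  rewrite /= ?GRing.oppr0 GRing.add0r.
Qed.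

Lemma dih_relations : dihedral_relations n.+1 dih_w dih_x.
Proof.
split.
- by congr pair; rewrite /= GRing.oppr0 GRing.addr0.
- by congr pair; rewrite /= ?GRing.oppr0 GRing.add0r GRing.addr0.
- by rewrite dih_xX; congr pair; apply: val_inj; rewrite /= modnn.
Qed.

Lemma dih_presentation : dihedral_presentation n.+1 dih_w dih_x.
Proof.
split; [| exact: dih_relations |].
  apply/eqP; rewrite eqEsubset subsetT /=; apply/subsetP=> a _.
  by rewrite (dih_val a) groupM // groupX // mem_gen // !inE eqxx ?orbT.
move=> hT w x [w2 wx xn]; exists (fun a => w ^+ a.1 * x ^+ a.2).
have ww : w * w = 1 by rewrite -w2 expgS expg1.
have xmod m : x ^+ (m %% n.+1) = x ^+ m.
  by rewrite [in RHS](divn_eq m n.+1) expgD mulnC expgM xn expg1n mul1g.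
have xN (i : 'I_n.+1) : x ^+ (- i : 'I_n.+1)%R = x ^- i.
  apply: (mulIg (x ^+ i)); rewrite mulVg -expgD -xmod /=.
  by rewrite modnDml subnK ?modnn // ltnW.
have xw i : x ^+ i * w = w * x ^- i.
  have wV : w^-1 = w by apply: (mulgI w); rewrite mulgV ww.
  have xw1 : x * w = w * x^-1.
    by rewrite -wx wV !mulgA ww mul1g.
  elim: i => [|i IHi]; first by rewrite expg0 invg1 mul1g mulg1.
  by rewrite expgS -mulgA IHi mulgA xw1 -mulgA -invgM -expgSr expgS.
split=> [[b i] [c j]||] /=.
- rewrite xmod expgD; case: c => /=; last first.
    by rewrite addbF expg0 mul1g mulgA.
  rewrite xN; case: b => /=; rewrite ?expg0 ?expg1 ?mul1g.
    by rewrite -mulgA [in RHS](mulgA _ w) xw !mulgA ww mul1g.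
  by rewrite !mulgA xw.
- by rewrite expg0 mulg1 expg1.
- by rewrite xmod expg0 mul1g expg1.
Qed.

End DihedralModel.

(* Main.v *)
(* Upper bound: the number of informed vertices at most doubles in a round.  If
   it doubles in each of the first Delta rounds, then the originator and the
   first vertex it calls acquire a newly informed neighbour in each of these
   rounds, so all their neighbours are informed before round Delta + 1, when
   neither can inform anyone; so at most 2 ^ Delta + (2 ^ Delta - 2) vertices are informed in the end.

   Construction: let every informed vertex call along w x ^ (2 ^ k - 1) in round
   k + 1, for k = 0, ..., Delta - 1, and along w again in the last round.  As
   x ^ i * w = w * x ^ - i, a message from u reaches u x ^ i and u w x ^ i for all
   i < 2 ^ (Delta - 1) in Delta rounds, and multiplication by w then negates
   the exponents modulo 2 ^ Delta - 1, which gives the missing ones. *)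
Require Import Defs.
From mathcomp Require Import all_boot all_fingroup all_algebra.
From mathcomp Require Import zify.
Local Open Scope group_scope.

(** * Upper bound on the number of vertices informed in a given number of rounds *)

Section Broadcast.
Variable G : graph.
Implicit Types (I J : {set G}) (C : {set G * G}) (s : seq {set G * G}).

Definition neighbours (a : G) : {set G} := [set v | adj a v].

(** A valid round may also call vertices that already know the message; such calls are discarded
    here. *)
Definition useful_callers I C : {set G} :=
  [set c.1 | c in [set c in C | c.2 \notin I]].

Lemma useful_callers_sub I C : valid_round I C ->
  {in useful_callers I C, forall a, a \in I /\ ~~ (neighbours a \subset I)}.
Proof.
case/andP=> /forall_inP val _ _ /imsetP[c /setIdP[cC c2] ->].
have /andP[c1 ad] := val c cC; split=> //.
by apply/subsetPn; exists c.2; rewrite ?inE.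
Qed.

(** Calls of one round are disjoint, so useful calls have distinct callers, and every newly informed
    vertex is the callee of a useful call. *)
Lemma card_after_round I C : valid_round I C ->
  #|after_round I C| <= #|I| + #|useful_callers I C|.
Proof.
case/andP=> _ /forall_inP dis.
rewrite -(cardsID I (after_round I C)).
apply: leq_add; first by rewrite subset_leq_card ?subsetIr.
rewrite /useful_callers card_in_imset => [|c d /setIdP[cC _] /setIdP[dC _] cd]; last first.
  apply/eqP; apply: contraT => ncd.
  have := forall_inP (dis c cC) d dC; rewrite ncd /= => /pred0P/(_ c.1).
  by rewrite /= !inE cd eqxx.
apply: leq_trans (leq_imset_card snd _); apply: subset_leq_card.
apply/subsetP=> v /setDP[/setUP[->//|/imsetP[c cC ->]] c2].
by apply/imsetP; exists c => //; rewrite inE cC.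
Qed.

Lemma card_after_round_double I C : valid_round I C ->
  #|after_round I C| <= 2 * #|I|.
Proof.
move=> val; apply: leq_trans (card_after_round I C val) _.
rewrite mul2n -addnn leq_add2l; apply: subset_leq_card.
by apply/subsetP=> a /(useful_callers_sub I C val)[].
Qed.

(** Doubling forces the useful callers, a subset of [I], to be all of [I]. *)
Lemma doubling_call I C a : valid_round I C ->
    2 * #|I| <= #|after_round I C| -> a \in I ->
  exists d, [/\ d \notin I, adj a d & d \in after_round I C].
Proof.
move=> val le2 aI.
have sub : useful_callers I C \subset I.
  by apply/subsetP=> b /(useful_callers_sub I C val)[].
have /eqP eqI : useful_callers I C == I.
  rewrite eqEcard sub /= -(leq_add2l #|I|) addnn -mul2n.
  exact: leq_trans le2 (card_after_round I C val).
move: aI; rewrite -{1}eqI => /imsetP[[b d] /setIdP[cC dI] ->] /=.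
exists d; split=> //; last by rewrite inE; apply/orP; right; apply/imsetP; exists (b, d).
by case/andP: val => /forall_inP/(_ _ cC)/andP[].
Qed.

Lemma informed_sub I s : I \subset informed I s.
Proof.
elim: s I => //= C s IHs I.
exact: subset_trans (subsetUl _ _) (IHs (after_round I C)).
Qed.

Lemma card_informed I s : valid_scheme I s ->
  #|informed I s| <= 2 ^ size s * #|I|.
Proof.
elim: s I => [|C s IHs] I /=; first by rewrite mul1n.
case/andP=> val /IHs le; apply: leq_trans le _.
by rewrite expnSr -mulnA leq_mul2l card_after_round_double ?orbT.
Qed.

(** No round more than doubles the informed set, so extremal growth overall must be extremal both in
    the first round and in the remaining ones. *)
Lemma doubling_rounds I C s : valid_scheme I (C :: s) ->
    2 ^ size (C :: s) * #|I| <= #|informed I (C :: s)| ->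
  2 * #|I| <= #|after_round I C| /\
  2 ^ size s * #|after_round I C| <= #|informed (after_round I C) s|.
Proof.
case/andP=> val vals /=; rewrite expnSr -mulnA => le.
split; first by rewrite -(leq_pmul2l (expn_gt0 2 (size s))) (leq_trans le) ?card_informed.
by apply: leq_trans le; rewrite leq_mul2l card_after_round_double ?orbT.
Qed.

(** By [doubling_call], each round informs a new neighbour of [a]. Neighbours informed at the start
    are counted too, which matters for a vertex that joins after the first round. *)
Lemma doubling_neighbours I s a : valid_scheme I s ->
    2 ^ size s * #|I| <= #|informed I s| -> a \in I ->
  #|neighbours a :&: I| + size s <= #|neighbours a :&: informed I s|.
Proof.
elim: s I => [|C s IHs] I; first by rewrite addn0.
move=> vals le aI; have [le1 les] := doubling_rounds I C s vals le.
have /andP[val val'] := vals.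
have [d [dI ad dJ]] := doubling_call I C a val le1 aI.
have aJ : a \in after_round I C by rewrite inE aI.
apply: leq_trans (IHs _ val' les aJ); rewrite addnS -addSn leq_add2r.
apply: proper_card; rewrite properE setIS ?subsetUl //=.
by apply/subsetPn; exists d; rewrite in_setI inE ad // (negPf dI).
Qed.

Lemma valid_scheme_rcons I s C :
  valid_scheme I (rcons s C) = valid_scheme I s && valid_round (informed I s) C.
Proof. by elim: s I => [|D s IHs] I /=; rewrite ?andbT // IHs andbA. Qed.

Lemma neighbours_saturated J a :
  max_degree G <= #|neighbours a :&: J| -> neighbours a \subset J.
Proof.
move=> le; apply/setIidPl/eqP; rewrite eqEcard subsetIl /=.
by apply: leq_trans le; apply: (leq_bigmax (F := fun a => #|neighbours a|)).
Qed.

(** The length of [s] is only bounded, since a broadcast time is a minimum and may fall short of the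
    allowed number of rounds. *)
Lemma card_informed_degree u s : 0 < max_degree G ->
    size s <= (max_degree G).+1 -> valid_scheme [set u] s ->
  #|informed [set u] s| <= 2 ^ (max_degree G).+1 - 2.
Proof.
set D := max_degree G => D0.
rewrite leq_eqVlt ltnS expnS -[X in _ - X]muln1 -mulnBr => /orP[/eqP|] szs vals; last first.
  apply: leq_trans (card_informed _ _ vals) _; rewrite cards1 muln1.
  apply: (@leq_trans (2 ^ D)); first by rewrite leq_exp2l.
  by have := leq_pexp2l (isT : 0 < 2) D0; lia.
case/lastP: s szs vals => // s C; rewrite size_rcons => -[szs].
rewrite valid_scheme_rcons => /andP[vals val].
rewrite /informed foldl_rcons -/(informed _ _); set J := informed _ _ in val *.
(* [J] is the informed set before the last round. If it has at most [2 ^ D - 1] elements, doubling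
   already gives the bound; otherwise all [D] earlier rounds doubled. *)
have [ltJ | geJ] := ltnP #|J| (2 ^ D).
  apply: leq_trans (card_after_round_double _ _ val) _.
  by rewrite leq_mul2l /= -ltnS subn1 prednK ?expn_gt0.
have leJ : #|J| <= 2 ^ D.
  by have := card_informed _ _ vals; rewrite cards1 muln1 szs.
have full : 2 ^ size s * #|[set u]| <= #|informed [set u] s|.
  by rewrite cards1 muln1 szs.
have uI : u \in [set u] by rewrite inE.
have Nu : neighbours u \subset J.
  apply: neighbours_saturated; apply: leq_trans (doubling_neighbours _ _ u vals full uI).
  by rewrite szs leq_addl.
(* The first round [C0] is split off to obtain the vertex [v] that [u] calls in it. *)
case: s szs @J vals val full geJ leJ Nu => [|C0 s] szs J vals val full geJ leJ Nu.
  by rewrite -szs in D0.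
have [le1 les] := doubling_rounds _ _ _ vals full; have /andP[val0 vals0] := vals.
have [v [vu uv vI]] := doubling_call _ _ u val0 le1 uI.
have Nv : neighbours v \subset J.
  apply: neighbours_saturated; apply: leq_trans (doubling_neighbours _ _ v vals0 les vI).
  (* Only [D - 1] rounds remain for [v], but its neighbour [u] is already informed and supplies the
     missing unit. *)
  rewrite -/D -szs /= -add1n leq_add2r card_gt0; apply/set0Pn; exists u.
  by rewrite !inE eqxx adj_sym uv.
have vJ : v \in J by apply: (subsetP (informed_sub (after_round [set u] C0) s)).
have uJ : u \in J by apply: (subsetP (informed_sub [set u] (C0 :: s))).
apply: leq_trans (card_after_round _ _ val) _.
have sub : useful_callers J C \subset (J :\ u) :\ v.
  apply/subsetP=> a /(useful_callers_sub J C val)[aJ Na]; rewrite !inE aJ andbT.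
  by apply/andP; split; apply: contraNneq Na => ->.
apply: leq_trans (leq_add leJ (subset_leq_card sub)) _.
have := cardsD1 u J; have := cardsD1 v (J :\ u).
rewrite !inE uJ vJ andbT -in_set1 vu => -> /= eJ.
by lia.
Qed.

End Broadcast.

Lemma order_of_broadcast_le (G : graph) : 0 < max_degree G ->
    broadcast_time G <= (max_degree G).+1 ->
  order_of G <= 2 ^ (max_degree G).+1 - 2.
Proof.
move=> D0 bt; rewrite /order_of -cardsT.
have [-> | [u _]] := set_0Vmem [set: G]; first by rewrite cards0.
have : broadcast_time_from u <= (max_degree G).+1.
  by apply: leq_trans bt; apply: leq_bigmax.
rewrite /broadcast_time_from; case: ex_minnP => t /existsP[s /andP[vals /eqP sT]] _ let_.
by rewrite -sT card_informed_degree ?size_tuple.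
Qed.

Lemma broadcast_time_le (G : graph) t :
  (forall u : G, can_broadcast u t) -> broadcast_time G <= t.
Proof.
move=> bu; apply/bigmax_leqP=> u _.
by rewrite /broadcast_time_from; case: ex_minnP => m _; apply.
Qed.

(** * Broadcasting in a Cayley graph by right translations *)

Section CayleyBroadcast.
Variables (gT : finGroupType) (S : {set gT}) (hS : connection_set S).
Local Notation G := (cayley_graph hS).

Definition reach (I : {set gT}) (ss : seq gT) : {set gT} :=
  foldl (fun J s => J :|: J :* s) I ss.

Lemma translation_round (I : {set G}) (s : gT) : s \in S ->
  exists2 C, valid_round I C & after_round I C = I :|: (I : {set gT}) :* s.
Proof.
(* Restricting to uninformed callees makes the calls disjoint: no callee is a caller, and right
   cancellation of [s] separates the callees of distinct callers. *)
move=> sS; pose C : {set G * G} :=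
  [set c | [&& c.1 \in I, c.2 \notin I & (c.2 : gT) == (c.1 : gT) * s]].
have inC a b : ((a, b) \in C) = [&& a \in I, b \notin I & b == (a : gT) * s].
  by rewrite inE.
exists C.
  apply/andP; split; apply/forall_inP=> -[a b]; rewrite inC => /and3P[aI bI /eqP bE].
    by rewrite aI; apply/existsP; exists s; rewrite sS bE eqxx.
  apply/forall_inP=> -[a' b']; rewrite inC => /and3P[aI' bI' /eqP bE'].
  apply/implyP=> /eqP ne; apply/pred0P=> v; apply/negP.
  case/andP=> /set2P[|] /= -> /set2P[|] /= e.
  - by apply: ne; rewrite bE bE' e.
  - by rewrite -e aI in bI'.
  - by rewrite e aI' in bI.
  - by apply: ne; rewrite e; congr pair; apply: (mulIg s); rewrite -bE -bE'.
apply/setP=> v; rewrite !in_setU; have [//|vI /=] := boolP (v \in I).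
apply/imsetP/rcosetP=> [[[a b]]|[a aI vE]].
  by rewrite inC => /and3P[aI _ /eqP ->] ->; exists a.
by exists (a, v); rewrite // inC aI vI vE eqxx.
Qed.

Lemma translation_scheme (I : {set G}) ss : all [in S] ss ->
  exists2 s, valid_scheme I s & size s = size ss /\ informed I s = reach I ss.
Proof.
elim: ss I => [|x ss IHss] I /=; first by exists [::].
case/andP=> xS /IHss{}IHss.
have [C val CE] := translation_round I x xS.
have [s vals [szs sE]] := IHss (after_round I C).
by exists (C :: s); rewrite /= ?val //= szs sE CE.
Qed.

Lemma can_broadcast_reach (u : G) ss : all [in S] ss ->
  reach [set (u : gT)] ss = [set: gT] -> can_broadcast u (size ss).
Proof.
move=> ssS ssT; have [s vals [szs sE]] := translation_scheme [set u] ss ssS.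
apply/existsP; rewrite -szs; exists (in_tuple s).
by rewrite vals sE; apply/eqP; exact: ssT.
Qed.

Lemma cayley_max_degree : max_degree G = #|S|.
Proof.
have degE (u : G) : #|[set v | adj u v]| = #|S|.
  (* The neighbourhood of [u] is the left translate of [S] by [u]. *)
  rewrite -(card_lcoset S u); apply: eq_card => v; rewrite inE.
  apply/existsP/lcosetP=> [[s /andP[sS /eqP <-]]|[s sS ->]]; first by exists s.
  by exists s; rewrite sS /=.
apply/eqP; rewrite eqn_leq; apply/andP; split.
  by apply/bigmax_leqP=> u _; rewrite degE.
by rewrite -(degE (1 : gT)) (leq_bigmax (F := fun u : G => #|[set v | adj u v]|)).
Qed.

End CayleyBroadcast.

(** * Consequences of the dihedral presentation: normal form and order *)

Lemma morph_expg (gT hT : groupType) (f : gT -> hT) :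
  {morph f : a b / a * b} -> forall k, {morph f : a / a ^+ k}.
Proof.
move=> fM k a; elim: k => [|k IHk]; last by rewrite !expgS fM IHk.
by apply: (mulgI (f 1)); rewrite !expg0 -fM !mulg1.
Qed.

Lemma dihedral_involution n (gT : groupType) (w x : gT) :
  dihedral_relations n w x -> w * w = 1.
Proof. by case=> w2 _ _; rewrite -w2 expgS expg1. Qed.

Lemma dihedral_commute n (gT : groupType) (w x : gT) i :
  dihedral_relations n w x -> x ^+ i * w = w * x ^- i.
Proof.
move=> rel; have ww := dihedral_involution _ _ _ _ rel; case: rel => _ wx _.
have wV : w^-1 = w by apply: (mulgI w); rewrite mulgV ww.
have xw : x * w = w * x^-1 by rewrite -wx wV !mulgA ww mul1g.
elim: i => [|i IHi]; first by rewrite expg0 invg1 mul1g mulg1.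
by rewrite expgS -mulgA IHi mulgA xw -mulgA -invgM -expgSr expgS.
Qed.

Section Dihedral.
Variables (m : nat) (gT : finGroupType) (w x : gT).
Hypothesis hD : dihedral_presentation m.+1 w x.

(** The universal property maps [gT] onto the concrete model. This is what keeps normal forms
    distinct; the relations alone would also hold in proper quotients. *)
Lemma dihedral_coordinates : exists f : gT -> bool * 'I_m.+1,
  forall (b : bool) i, f (w ^+ b * x ^+ i) = (b, inZp i).
Proof.
have [_ _ univ] := hD.
have [f [fM fw fx]] := univ (dihedral m) _ _ (dih_relations m).
exists f => b i; rewrite fM !(morph_expg _ _ _ fM) fw fx dih_xX.
by case: b; congr pair; rewrite /= ?GRing.oppr0 GRing.add0r.
Qed.

(** The model satisfies the presentation as well, so it maps to [gT]; the image is a subgroup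
    containing [w] and [x], hence everything. *)
Lemma dihedral_normal_form (a : gT) :
  exists (b : bool) (i : 'I_m.+1), a = w ^+ b * x ^+ i.
Proof.
have [gen rel _] := hD; have [_ _ univ] := dih_presentation m.
have [g [gM gw gx]] := univ gT w x rel.
have gE b : g b = w ^+ b.1 * x ^+ b.2.
  by rewrite [in LHS](dih_val b) gM !(morph_expg _ _ _ gM) gw gx.
have grp : group_set (g @: setT).
  apply/group_setP; split.
    by apply/imsetP; exists 1; rewrite // -[LHS](morph_expg _ _ _ gM 0 1).
  by move=> _ _ /imsetP[b _ ->] /imsetP[c _ ->]; rewrite -gM imset_f.
have : a \in Group grp.
  have /subsetP : [set: gT] \subset Group grp.
    by rewrite -gen gen_subG subUset !sub1set -gw -gx !imset_f.
  by apply; rewrite inE.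
by case/imsetP=> b _ ->; exists b.1, b.2.
Qed.

Lemma dihedral_card : #|gT| = (2 * m.+1)%N.
Proof.
have [f fE] := dihedral_coordinates.
pose g (b : bool * 'I_m.+1) := w ^+ b.1 * x ^+ b.2.
have gK : cancel g f by case=> b i; rewrite fE valZpK.
rewrite -card_bool -[in RHS](card_ord m.+1) -card_prod.
apply/esym/(bij_eq_card (f := g)); exists f => // a.
by have [b [i ->]] := dihedral_normal_form a; rewrite -/(g (b, i)) gK.
Qed.

Lemma dihedral_reflection_inj i j : i < m.+1 -> j < m.+1 ->
  w * x ^+ i = w * x ^+ j -> i = j.
Proof.
have [f fE] := dihedral_coordinates; move=> lti ltj /(congr1 f).
have := fE true i; have := fE true j; rewrite /= !expg1 => -> -> [].
by rewrite !modn_small.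
Qed.

Lemma dihedral_reflection_neq1 i : w * x ^+ i != 1.
Proof.
have [f fE] := dihedral_coordinates; apply/eqP=> /(congr1 f).
have := fE true i; have := fE false 0.
by rewrite /= !expg1 mulg1 => -> ->.
Qed.

End Dihedral.

(** * The Cayley graph of the theorem: degree, order and broadcast scheme *)

Section DihedralBroadcast.
Variables (d : nat) (gT : finGroupType) (w x : gT).
Hypothesis hD : dihedral_presentation (2 ^ d.+1 - 1)%N w x.
Local Notation n := (2 ^ d.+1 - 1)%N.
Local Notation S := (dihedral_generators d.+1 w x).

Let hD' : dihedral_presentation n.-1.+1 w x.
Proof.
by rewrite prednK // subn_gt0 -[1%N](expn0 2) ltn_exp2l.
Qed.

Let rel : dihedral_relations n w x. Proof. by case: hD. Qed.

(** These reflections define a Knödel graph; the index starts at 0, one below that of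
    [dihedral_generators]. *)
Definition knodel_generator k := w * x ^+ (2 ^ k - 1).

Lemma knodel_generator_in k : k < d.+1 -> knodel_generator k \in S.
Proof.
move=> ltk; apply/imsetP; exists (Ordinal (ltk : k.+1 < d.+2)) .
  by rewrite inE.
by rewrite /knodel_generator /= subSS subn0.
Qed.

Lemma knodel_generatorP s :
  reflect (exists2 k, k < d.+1 & s = knodel_generator k) (s \in S).
Proof.
apply: (iffP idP) => [/imsetP[[[|k] ltk]] | [k ltk ->]].
- by rewrite inE.
- by move=> _ ->; exists k; rewrite // /knodel_generator /= subSS subn0.
- exact: knodel_generator_in.
Qed.

Lemma knodel_generator0 : knodel_generator 0 = w.
Proof. by rewrite /knodel_generator mulg1. Qed.

Lemma knodel_generator_w : w \in S.
Proof. by apply/knodel_generatorP; exists 0%N; rewrite ?knodel_generator0. Qed.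

Lemma knodel_connection : connection_set S.
Proof.
have [gen _ _] := hD; split.
- apply/eqP; rewrite eqEsubset subsetT -gen gen_subG subUset !sub1set.
  have wS : w \in <<S>> by rewrite mem_gen // knodel_generator_w.
  (* For [d = 0] the only generator is [w], but then the relation on [x] has exponent 1 and [x] is
     trivial. *)
  rewrite wS /=; case: (posnP d) => [d0 | d0].
    by have [_ _ xn] := rel; move: xn; rewrite d0 expg1 => ->; rewrite group1.
  have: w * x \in <<S>>.
    by rewrite mem_gen //; apply/knodel_generatorP; exists 1%N; rewrite // /knodel_generator expg1.
  by rewrite groupMl.
- move=> s sS; have /knodel_generatorP[k _ sE] := sS; suff -> : s^-1 = s by [].
  apply: (mulgI s); rewrite mulgV sE /knodel_generator mulgA -(mulgA w).
  by rewrite (dihedral_commute _ _ _ _ _ rel) mulgA (dihedral_involution _ _ _ _ rel) mul1g mulVg.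
- apply/negP=> /knodel_generatorP[k _ /esym/eqP]; apply/negP.
  exact: dihedral_reflection_neq1 hD' _.
Qed.

Lemma knodel_degree : #|S| = d.+1.
Proof.
rewrite card_in_imset => [|k l]; last first.
  rewrite !inE => k0 l0 /(dihedral_reflection_inj _ _ _ _ hD').
  have ltn (i : 'I_d.+2) : 2 ^ (i - 1) - 1 < n.-1.+1.
    have : 2 ^ (i - 1) < 2 ^ d.+1 by rewrite ltn_exp2l //; have := ltn_ord i; lia.
    have := expn_gt0 2 (i - 1); lia.
  move=> /(_ (ltn k) (ltn l)) e; apply: val_inj => /=.
  have : (2 ^ (k - 1) = 2 ^ (l - 1))%N.
    by have := expn_gt0 2 (k - 1); have := expn_gt0 2 (l - 1); lia.
  (* Truncated subtraction gives the indices 0 and 1 the same exponent; [k0] and [l0] exclude index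
     0. *)
  by move/(expnI (isT : 1 < 2)); lia.
rewrite (eq_card (B := predC1 ord0)) ?cardC1 ?card_ord // => k.
by rewrite !inE lt0n.
Qed.

(** Right multiplication by generator [k.+1] toggles the factor [w] and replaces the exponent [j] by
    [2 ^ k.+1 - 1 - j], which carries the exponents below [2 ^ k] onto the next [2 ^ k] ones. *)
Lemma reach_translates (u : gT) k i : i < 2 ^ k ->
  let J := reach _ [set u] [seq knodel_generator l | l <- iota 0 k.+1] in
  u * x ^+ i \in J /\ u * w * x ^+ i \in J.
Proof.
elim: k i => [|k IHk] i.
  rewrite expn0 ltnS leqn0 => /eqP-> /=; rewrite knodel_generator0 expg0 !mulg1.
  by rewrite !in_setU !mem_rcoset mulgK !in_set1 eqxx orbT.
rewrite -[k.+2]addn1 iotaD map_cat /reach foldl_cat -/(reach _ _ _) /= add0n.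
set J := reach _ _ _ in IHk * => lti.
have [/IHk[xJ wJ] | gei] := ltnP i (2 ^ k).
  by rewrite !in_setU xJ wJ.
pose j := (2 ^ k.+1 - 1 - i)%N.
have eij : (2 ^ k.+1 - 1 = j + i)%N by rewrite subnK // -ltnS subn1 prednK ?expn_gt0.
have /IHk[xJ wJ] : j < 2 ^ k by move: lti gei eij; rewrite expnS; lia.
have xwx : x ^+ j * knodel_generator k.+1 = w * x ^+ i.
  by rewrite /knodel_generator eij mulgA (dihedral_commute _ _ _ _ _ rel) expgD -mulgA mulKg.
rewrite !in_setU; split; apply/orP; right; apply/rcosetP.
  exists (u * w * x ^+ j) => //.
  by rewrite -!mulgA xwx !mulgA -(mulgA u) (dihedral_involution _ _ _ _ rel) mulg1.
by exists (u * x ^+ j); rewrite // -!mulgA xwx.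
Qed.

Lemma knodel_broadcast_time : broadcast_time (cayley_graph knodel_connection) <= d.+2.
Proof.
apply: broadcast_time_le => u.
pose ss := rcons [seq knodel_generator l | l <- iota 0 d.+1] w.
have -> : d.+2 = size ss by rewrite size_rcons size_map size_iota.
apply: can_broadcast_reach.
  rewrite all_rcons knodel_generator_w andTb.
  apply/allP=> _ /mapP[k kd ->]; apply: knodel_generator_in.
  by move: kd; rewrite mem_iota.
apply/eqP; rewrite eqEsubset subsetT; apply/subsetP=> a _.
rewrite /reach foldl_rcons -/(reach _ _ _).
have := reach_translates u d; set J := reach _ _ _ => Jhalf.
(* The target is written relative to the originator [u], since calls multiply on the right. *)
have [b [i aE]] := dihedral_normal_form _ _ _ _ hD' (u^-1 * a).
have {aE}-> : a = u * w ^+ b * x ^+ i by rewrite -mulgA -aE mulKVg.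
have [/Jhalf[xJ wJ] | gei] := ltnP i (2 ^ d).
  by rewrite in_setU; case: b; rewrite ?expg0 ?mulg1 ?expg1 ?xJ ?wJ.
have lti : i < n.
  by have := ltn_ord i; have := leq_pexp2l (isT : 0 < 2) (ltn0Sn d); lia.
move: (nat_of_ord i) lti gei => {}i lti gei.
(* As [n] is [2 ^ d.+1 - 1], an exponent of at least [2 ^ d] has its negative modulo [n] among those
   already reached. *)
have /Jhalf[xJ wJ] : n - i < 2 ^ d by move: lti gei; rewrite expnS; lia.
have xw : x ^+ (n - i) * w = w * x ^+ i.
  rewrite (dihedral_commute _ _ _ _ _ rel); congr (_ * _).
  apply: (mulgI (x ^+ (n - i))); rewrite mulgV -expgD subnK ?(ltnW lti) //.
  by case: rel => _ _ ->.
rewrite in_setU; apply/orP; right; apply/rcosetP; case: b.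
  by exists (u * x ^+ (n - i)); rewrite // expg1 -!mulgA xw.
exists (u * w * x ^+ (n - i)) => //.
by rewrite -!mulgA xw expg0 mul1g !mulgA -(mulgA u) (dihedral_involution _ _ _ _ rel) mulg1.
Qed.

Lemma knodel_order : #|gT| = (2 ^ d.+2 - 2)%N.
Proof.
rewrite (dihedral_card _ _ _ _ hD') (expnS 2 d.+1).
by have := expn_gt0 2 d.+1; have := leq_pexp2l (isT : 0 < 2) (ltn0Sn d); lia.
Qed.

End DihedralBroadcast.

Theorem theorem1 (Delta : nat) (hDelta : (1 <= Delta)%N)
    (gT : finGroupType) (w x : gT)
    (hD : dihedral_presentation (2 ^ Delta - 1)%N w x) :
  exists hS : connection_set (dihedral_generators Delta w x),
    let G := cayley_graph hS in
    optimal_broadcast_network Delta Delta.+1 G /\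
    [/\ max_degree G = Delta,
        (broadcast_time G <= Delta.+1)%N,
        order_of G = (2 ^ Delta.+1 - 2)%N &
        is_max_order Delta Delta.+1 (2 ^ Delta.+1 - 2)%N].
Proof.
case: Delta hDelta hD => // d _ hD; exists (knodel_connection _ _ _ _ hD) => G.
have degG : max_degree G = d.+1 by rewrite cayley_max_degree (knodel_degree _ _ _ _ hD).
have btG : broadcast_time G <= d.+2 by exact: knodel_broadcast_time.
have ordG : order_of G = (2 ^ d.+2 - 2)%N by exact: knodel_order hD.
have opt : is_max_order d.+1 d.+2 (2 ^ d.+2 - 2)%N.
  (* [G] itself attains the upper bound. *)
  split; first by exists G.
  by move=> H degH btH; rewrite -degH order_of_broadcast_le ?degH.
by split; split; rewrite // ordG.
Qed.
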